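(* Let $M$ be a monoid and $R$ a ring. If $R$ is $M$-central Armendariz, then either $R$ is commutative or $M$ is cancellative.
   Context: All rings are associative with identity. $C(R)$ denotes the center of a ring $R$, and $R[M]$ denotes the monoid ring of a monoid $M$ over $R$. A ring $R$ is called $M$-central Armendariz if whenever $\alpha=a_1g_1+\dots+a_mg_m\in R[M]$ and $\beta=b_1h_1+\dots+b_nh_n\in R[M]$ (with $a_i,b_j\in R$, $g_1,\dots,g_m\in M$ pairwise distinct, and $h_1,\dots,h_n\in M$ pairwise distinct) satisfy $\alpha\beta=0$, then $a_ib_j\in C(R)$ for all $1\le i\le m$ and $1\le j\le n$. A monoid is cancellative if it is both left and right cancellative. *)

(* Defs.v *)
From HB Require Import structures.
From mathcomp Require Import all_boot all_algebra finmap.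
From mathcomp.multinomials Require Import monalg.

Set Implicit Arguments.
Unset Strict Implicit.
Unset Printing Implicit Defensive.

Import GRing.Theory.

Local Open Scope fset_scope.
Local Open Scope ring_scope.

(* The library puts a ring structure on {malg R[M]} only for M : monomType,   *)
(* i.e. for monoids in which 1 is the only invertible element. For an         *)
(* arbitrary monoid, monring R M is the same additive group of finitely       *)
(* supported functions M -> R, with its own convolution product.              *)
Definition monring (R : pzRingType) (M : monoidType) : predArgType :=
  {malg R[M]}.

HB.instance Definition _ (R : pzRingType) (M : monoidType) :=
  GRing.Zmodule.copy (monring R M) {malg R[M]}.

Section MonoidRing.
Context {R : pzRingType} {M : monoidType}.

Implicit Types (x y z : monring R M) (g h : M) (a b : R).

Definition monring_one : monring R M := << 1 *g 1%g >>.

Definition monring_mul x y : monring R M :=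
  \sum_(g <- msupp x) \sum_(h <- msupp y) << x@_g * y@_h *g (g * h)%g >>.

Lemma monring_mulw (d e : {fset M}) x y :
    msupp x `<=` d -> msupp y `<=` e ->
  monring_mul x y = \sum_(g <- d) \sum_(h <- e) << x@_g * y@_h *g (g * h)%g >>.
Proof.
move=> xd ye; rewrite /monring_mul (big_fset_incl _ xd) /=.
  apply: eq_bigr => g _; apply: big_fset_incl => // h _ /mcoeff_outdom ->.
  by rewrite mulr0 monalgU0.
move=> g _ /mcoeff_outdom xg.
by rewrite big1 // => h _; rewrite xg mul0r monalgU0.
Qed.

Lemma monring_mul0l y : monring_mul 0 y = 0.
Proof. by rewrite /monring_mul msupp0 big_seq_fset0. Qed.

Lemma monring_mul0r x : monring_mul x 0 = 0.
Proof.
by rewrite /monring_mul big1 // => g _; rewrite msupp0 big_seq_fset0.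
Qed.

Lemma monring_mulUU a b g h :
  monring_mul << a *g g >> << b *g h >> = << a * b *g (g * h)%g >>.
Proof.
by rewrite (monring_mulw msuppU_le msuppU_le) !big_seq_fset1 !mcoeffUU.
Qed.

Lemma monring_mulDl : left_distributive monring_mul +%R.
Proof.
move=> x y z; have zz := fsubset_refl (msupp z).
rewrite (monring_mulw (msuppD_le x y) zz).
rewrite (monring_mulw (fsubsetUl _ (msupp y)) zz).
rewrite (monring_mulw (fsubsetUr (msupp x) _) zz).
rewrite -big_split /=; apply: eq_bigr => g _.
rewrite -big_split /=; apply: eq_bigr => h _.
by rewrite mcoeffD mulrDl monalgUD.
Qed.

Lemma monring_mulDr : right_distributive monring_mul +%R.
Proof.
move=> z x y; have zz := fsubset_refl (msupp z).
rewrite (monring_mulw zz (msuppD_le x y)).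
rewrite (monring_mulw zz (fsubsetUl _ (msupp y))).
rewrite (monring_mulw zz (fsubsetUr (msupp x) _)).
rewrite -big_split /=; apply: eq_bigr => g _.
rewrite -big_split /=; apply: eq_bigr => h _.
by rewrite mcoeffD mulrDr monalgUD.
Qed.

Lemma monring_mul_suml (I : Type) (r : seq I) (F : I -> monring R M) y :
  monring_mul (\sum_(i <- r) F i) y = \sum_(i <- r) monring_mul (F i) y.
Proof.
exact: (big_morph (monring_mul^~ y) (fun _ _ => monring_mulDl _ _ _)
                  (monring_mul0l y)).
Qed.

Lemma monring_mul_sumr (I : Type) (r : seq I) (F : I -> monring R M) x :
  monring_mul x (\sum_(i <- r) F i) = \sum_(i <- r) monring_mul x (F i).
Proof.
exact: (big_morph (monring_mul x) (fun _ _ => monring_mulDr _ _ _)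
                  (monring_mul0r x)).
Qed.

Lemma monringE x :
  x = \sum_(g <- msupp x) (<< x@_g *g g >> : monring R M).
Proof. exact: monalgE. Qed.

Lemma monring_mulA : associative monring_mul.
Proof.
move=> x y z; rewrite [x]monringE !monring_mul_suml; apply: eq_bigr => g _.
rewrite [y]monringE monring_mul_suml !monring_mul_sumr monring_mul_suml.
apply: eq_bigr => h _.
rewrite [z]monringE !monring_mul_sumr; apply: eq_bigr => k _.
by rewrite !monring_mulUU mulrA mulgA.
Qed.

Lemma monring_mul1l : left_id monring_one monring_mul.
Proof.
move=> x; rewrite {1}[x]monringE monring_mul_sumr [RHS]monringE.
by apply: eq_bigr => g _; rewrite monring_mulUU mul1r mul1g.
Qed.

Lemma monring_mul1r : right_id monring_one monring_mul.
Proof.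
move=> x; rewrite {1}[x]monringE monring_mul_suml [RHS]monringE.
by apply: eq_bigr => g _; rewrite monring_mulUU mulr1 mulg1.
Qed.

End MonoidRing.

HB.instance Definition _ (R : pzRingType) (M : monoidType) :=
  GRing.Zmodule_isPzRing.Build (monring R M) (@monring_mulA R M)
    (@monring_mul1l R M) (@monring_mul1r R M)
    (@monring_mulDl R M) (@monring_mulDr R M).

Definition in_center (R : pzRingType) (x : R) : Prop :=
  forall y : R, GRing.comm x y.

Definition formal_sum (R : pzRingType) (M : monoidType) (n : nat)
    (a : 'I_n -> R) (g : 'I_n -> M) : monring R M :=
  \sum_(i < n) (<< a i *g g i >> : monring R M).

Definition central_Armendariz (M : monoidType) (R : pzRingType) : Prop :=
  forall (m n : nat) (a : 'I_m -> R) (g : 'I_m -> M)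
         (b : 'I_n -> R) (h : 'I_n -> M),
    injective g -> injective h ->
    formal_sum a g * formal_sum b h = 0 ->
    forall (i : 'I_m) (j : 'I_n), in_center (a i * b j).

Definition cancellative (M : monoidType) : Prop :=
  (forall x : M, injective (fun y => (x * y)%g))
  /\ (forall x : M, injective (fun y => (y * x)%g)).

(* Main.v *)
Require Import Defs.
From mathcomp Require Import all_boot all_algebra.
From mathcomp.multinomials Require Import monalg.
From Stdlib Require Import Classical_Prop.

Import GRing.Theory.

Local Open Scope ring_scope.

(** If cancellation fails on the left, say [x * y = x * z] with [y] and [z]
    distinct, then each [a] in [R] yields a zero product
    [(a x) (y - z) = a (x y) - a (x z) = 0] in the monoid ring. Its
    coefficient products are [a] and [- a], so the central Armendariz
    condition makes [a] central; as [a] is arbitrary, [R] is commutative.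
    A failure on the right is symmetric, with [(y - z) (a x) = 0].
    The two collision lemmas below carry this out. The disjunction then
    follows from excluded middle on the commutativity of [R]. *)

(** [diff_coef] and [diff_supp] present the element [y - z] of the monoid ring
    as a formal sum, the shape that [central_Armendariz] quantifies over. *)
Definition diff_coef (R : pzRingType) (j : 'I_2) : R :=
  if j == ord0 then 1 else - 1.

Definition diff_supp (M : monoidType) (y z : M) (j : 'I_2) : M :=
  if j == ord0 then y else z.

Lemma diff_supp_inj (M : monoidType) (y z : M) :
  y != z -> injective (diff_supp M y z).
Proof.
move=> /eqP yz; rewrite /diff_supp => -[[|[|//]] i0] [[|[|//]] j0] //= E;
  by [apply/val_inj | case: yz].
Qed.

Lemma formal_sum_single (R : pzRingType) (M : monoidType) (a : R) (x : M) :
  formal_sum (fun _ : 'I_1 => a) (fun=> x) = << a *g x >> :> monring R M.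
Proof. by rewrite /formal_sum big_ord1. Qed.

Lemma formal_sum_diff (R : pzRingType) (M : monoidType) (y z : M) :
  formal_sum (diff_coef R) (diff_supp M y z)
    = (<< 1 *g y >> : monring R M) + (<< - 1 *g z >> : monring R M).
Proof. by rewrite /formal_sum big_ord_recl big_ord1. Qed.

(** A collision of two products in [M] reduces the product of the two test
    elements to a sum of this form. *)
Lemma monalg_opp_cancel (R : pzRingType) (M : monoidType) (a : R) (g : M) :
  (<< a *g g >> : monring R M) + (<< - a *g g >> : monring R M) = 0.
Proof. by rewrite -[LHS]monalgUD subrr monalgU0. Qed.

Lemma commutative_of_left_collision (M : monoidType) (R : pzRingType)
    (x y z : M) :
  central_Armendariz M R -> y != z -> (x * y)%g = (x * z)%g ->
  commutative (@GRing.mul R).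
Proof.
move=> hA yz xyz a b.
have inj1 : injective (fun _ : 'I_1 => x) by move=> i j _; rewrite !ord1.
have := hA _ _ (fun=> a) _ (diff_coef R) _ inj1 (diff_supp_inj M y z yz).
rewrite formal_sum_single formal_sum_diff mulrDr.
rewrite [X in X + _]monring_mulUU [X in _ + X]monring_mulUU.
rewrite mulr1 mulrN1 xyz monalg_opp_cancel => /(_ erefl ord0 ord0 b).
by rewrite /diff_coef /= mulr1.
Qed.

Lemma commutative_of_right_collision (M : monoidType) (R : pzRingType)
    (x y z : M) :
  central_Armendariz M R -> y != z -> (y * x)%g = (z * x)%g ->
  commutative (@GRing.mul R).
Proof.
move=> hA yz yzx a b.
have inj1 : injective (fun _ : 'I_1 => x) by move=> i j _; rewrite !ord1.
have := hA _ _ (diff_coef R) _ (fun=> a) _ (diff_supp_inj M y z yz) inj1.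
rewrite formal_sum_single formal_sum_diff mulrDl.
rewrite [X in X + _]monring_mulUU [X in _ + X]monring_mulUU.
rewrite mul1r mulN1r yzx monalg_opp_cancel => /(_ erefl ord0 ord0 b).
by rewrite /diff_coef /= mul1r.
Qed.

Theorem theorem2p4 (M : monoidType) (R : pzRingType)
    (hA : central_Armendariz M R) :
  commutative (@GRing.mul R) \/ cancellative M.
Proof.
case: (classic (commutative (@GRing.mul R))) => [|ncomm]; [by left | right].
split=> x y z /= E; case: (eqVneq y z) => // yz; case: ncomm.
- exact: commutative_of_left_collision hA yz E.
- exact: commutative_of_right_collision hA yz E.
Qed.
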